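(* Let $\omega(k)$ be any sequence with $\omega(k)\to\infty$. Then with probability tending to $1$ as $k\to\infty$, $$k^2\log k-(1-\gamma)k^2-\omega(k)k^{3/2}\le X_k\le k^2\log k+\gamma k^2+\omega(k)k^{3/2}.$$
   Context: Fix $k\ge 1$. Start with the empty word and at each time step append a letter chosen independently and uniformly at random from $[k]=\{1,\ldots,k\}$. $X_k$ is the first time step at which the current word is a superpattern for all length-$k$ preferential arrangements on $[k]$, i.e. contains, as a (not necessarily contiguous) subsequence order isomorphic to it, every string of length $k$ over positive integers up to order isomorphism; equivalently, the first time the word contains every permutation of $[k]$ as a subsequence. Here $\gamma$ is Euler's constant and $\log$ is the natural logarithm. *)

(* Defs.v *)
From HB Require Import structures.
From mathcomp Require Import all_boot all_order all_algebra finmap.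
From mathcomp Require Import all_classical all_reals all_analysis.

Set Implicit Arguments.
Unset Strict Implicit.
Unset Printing Implicit Defensive.

Import Order.TTheory GRing.Theory Num.Theory.
Import numFieldNormedType.Exports.

Local Open Scope classical_set_scope.
Local Open Scope ring_scope.

Definition euler_gamma (R : realType) : R :=
  lim (((\sum_(1 <= i < n.+1) (i%:R : R)^-1) - ln n%:R) @[n --> \oo]).

Definition order_isomorphic (s t : seq nat) : Prop :=
  size s = size t /\
  forall i j, (i < size s)%N -> (j < size s)%N ->
    (nth 0%N s i < nth 0%N s j)%N = (nth 0%N t i < nth 0%N t j)%N.

Definition contains_pattern (w s : seq nat) : Prop :=
  exists2 u, subseq u w & order_isomorphic u s.

(* Ties are allowed in [s]: up to order isomorphism, the strings of length [k]
   over the positive integers are the length-[k] preferential arrangements. *)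
Definition superpattern (k : nat) (w : seq nat) : Prop :=
  forall s : seq nat, size s = k -> all (leq 1) s -> contains_pattern w s.

(* [w i] is the letter appended at step [i.+1]; the value is [+oo] when no
   prefix of [w] is a superpattern. *)
Definition superpattern_time (R : realType) (k : nat) (w : nat -> nat) :
    \bar R :=
  ereal_inf [set n%:R%:E | n in [set n | superpattern k (mkseq w n)]].

Definition mutually_independent (d : measure_display) (T : measurableType d)
    (R : realType) (P : probability T R) (d' : measure_display)
    (T' : measurableType d') (I : choiceType) (X : I -> {RV P >-> T'}) : Prop :=
  forall (J : {fset I}) (A : I -> set T'),
    (forall i, i \in J -> measurable (A i)) ->
    P (\bigcap_(i in [set` J]) X i @^-1` A i) =
    (\prod_(i <- J) P (X i @^-1` A i))%E.

(* The [k] point masses add up to 1, so [X] lies in {1, ..., k} almost surely. *)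
Definition uniform_letter (d : measure_display) (T : measurableType d)
    (R : realType) (P : probability T R) (k : nat) (X : {RV P >-> nat}) : Prop :=
  forall a : nat, (1 <= a <= k)%N -> P (X @^-1` [set a]) = ((k%:R)^-1)%:E.

Definition iid_uniform_letters (d : measure_display) (T : measurableType d)
    (R : realType) (P : probability T R) (k : nat)
    (X : nat -> {RV P >-> nat}) : Prop :=
  mutually_independent X /\ forall n, uniform_letter k (X n).

(* Main.v *)
(* Cut the random word greedily into successive complete collections of the
   alphabet. After k of them every word of length k over [k] has occurred as a
   subsequence. Conversely, an adversary builds a permutation by always asking
   next for the remaining letter that shows up last, so that containing every
   permutation forces collections of k, k - 1, ..., 1 letters one after the
   other. Both times are sums of independent geometric variables, with means
   k^2 H_k and k ((k + 1) H_k - k) and variances at most 2 k^3, and Chebyshev's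
   inequality concludes. It is obtained without stopping times: the quantity
   v + (mu + e - n)^2 of the current state, with n letters still to be read, mu
   and v the mean and variance bound of the remaining time, is a
   supermartingale. *)
Require Import Defs.
From mathcomp Require Import all_boot all_order all_algebra.
From mathcomp Require Import all_classical all_reals all_analysis.
From mathcomp Require Import finmap ring lra zify.

Import Order.TTheory GRing.Theory Num.Theory.
Import numFieldNormedType.Exports.

Local Open Scope classical_set_scope.
Local Open Scope ring_scope.

(** * Superpatterns, permutations and words over the alphabet *)

Lemma mkseq_subseq (w : nat -> nat) (m n : nat) :
  (m <= n)%N -> subseq (mkseq w m) (mkseq w n).
Proof.
by move=> /subnKC <-; rewrite /mkseq iotaD map_cat; exact: prefix_subseq.
Qed.

Lemma superpattern_subseq (k : nat) (v w : seq nat) :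
  subseq v w -> superpattern k v -> superpattern k w.
Proof.
move=> vw sv s sk s1; have [u uv us] := sv s sk s1.
by exists u => //; exact: subseq_trans vw.
Qed.

(** Recovers a letter of a permutation from a quantity that depends only on relative order. *)
Lemma count_ltn_perm_iota (k x : nat) (u : seq nat) :
  perm_eq u (iota 1 k) -> x \in u -> count (fun y => (y < x)%N) u = x.-1.
Proof.
move=> uk; rewrite (perm_mem uk) mem_iota => /andP[x0 xk].
rewrite (permP uk) -size_filter.
rewrite (_ : [seq y <- iota 1 k | _] = iota 1 x.-1) ?size_iota//.
apply: (irr_sorted_eq ltn_trans ltnn).
- by apply: sorted_filter; [exact: ltn_trans|exact: iota_ltn_sorted].
- exact: iota_ltn_sorted.
by move=> y; rewrite mem_filter !mem_iota; lia.
Qed.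

(** Order isomorphism transports distinctness from [p] to [u], so [u] is a permutation too; letters
    in equal positions then have equally many smaller letters. *)
Lemma order_isomorphic_perm_iota (k : nat) (u p : seq nat) :
  all (fun x => (1 <= x <= k)%N) u -> perm_eq p (iota 1 k) ->
  order_isomorphic u p -> u = p.
Proof.
move=> /allP uk pk [sup up].
have sp : size p = k by rewrite (perm_size pk) size_iota.
have p_uniq : uniq p by rewrite (perm_uniq pk) iota_uniq.
have u_uniq : uniq u.
  apply/(uniqP 0%N) => i j /= iu ju uij.
  apply/eqP; rewrite -(nth_uniq 0%N _ _ p_uniq) -?sup//.
  have := up i j iu ju; have := up j i ju iu; rewrite uij ltnn.
  move=> /esym/negbT + /esym/negbT; rewrite -!leqNgt => ji ij.
  by rewrite eqn_leq ji ij.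
have uk' : perm_eq u (iota 1 k).
  apply: uniq_perm => //; first exact: iota_uniq.
  have [x /uk||//] := @uniq_min_size _ u (iota 1 k) u_uniq.
    by rewrite mem_iota; lia.
  by rewrite size_iota sup sp.
apply: (@eq_from_nth _ 0%N) => // i iu.
have ui : nth 0%N u i \in u by exact: mem_nth.
have pi : nth 0%N p i \in p by rewrite mem_nth -?sup.
have cE : count (fun y => (y < nth 0%N u i)%N) u =
          count (fun y => (y < nth 0%N p i)%N) p.
  (* Each count is the number of [true] entries in a list of comparisons, and the two lists agree by
     [up]. *)
  rewrite -(count_map (fun y => (y < nth 0%N u i)%N) id).
  rewrite -(count_map (fun y => (y < nth 0%N p i)%N) id); congr count.
  apply: (@eq_from_nth _ false); rewrite ?size_map// => j ju.
  by rewrite !(nth_map 0%N) -?sup// up.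
move: cE; rewrite (count_ltn_perm_iota _ _ _ uk' ui).
rewrite (count_ltn_perm_iota _ _ _ pk pi).
have := uk _ ui; move: pi; rewrite (perm_mem pk) mem_iota; lia.
Qed.

Lemma superpattern_perm (k : nat) (w p : seq nat) :
  all (fun x => (1 <= x <= k)%N) w -> superpattern k w ->
  perm_eq p (iota 1 k) -> subseq p w.
Proof.
move=> wk sw pk.
have [||u uw up] := sw p.
- by rewrite (perm_size pk) size_iota.
- by apply/allP => x; rewrite (perm_mem pk) mem_iota => /andP[].
suff <- : u = p by [].
apply: (order_isomorphic_perm_iota k) => //.
by apply/allP => x /(mem_subseq uw) /(allP wk).
Qed.

(** Each letter of [s] is replaced by one plus the number of strictly smaller entries. This keeps
    order and ties, and stays at most [k] because an entry does not count itself. *)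
Lemma superpattern_all_words (k : nat) (w : seq nat) :
  (forall u, size u = k -> all (fun x => (1 <= x <= k)%N) u -> subseq u w) ->
  superpattern k w.
Proof.
move=> kw s sk _; pose rank x := (count (fun y => (y < x)%N) s).+1.
have rank_le x y : (x <= y)%N -> (rank x <= rank y)%N.
  by move=> xy; rewrite ltnS; apply: sub_count => z /= /leq_trans; apply.
have rank_lt x y : x \in s -> (x < y)%N -> (rank x < rank y)%N.
  move=> xs xy; rewrite ltnS /rank !(permP (perm_to_rem xs)) /= ltnn xy.
  by rewrite add0n add1n ltnS; apply: sub_count => z /= /ltn_trans; apply.
exists (map rank s).
  apply: kw; first by rewrite size_map.
  apply/allP => _ /mapP[x xs ->].
  rewrite /rank (permP (perm_to_rem xs)) /= ltnn add0n.
  apply: leq_ltn_trans (count_size _ _) _.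
  by rewrite size_rem// sk ltn_predL -sk; case: (s) xs.
split; first by rewrite size_map.
move=> i j; rewrite size_map => si sj; rewrite !(nth_map 0%N)//.
have [ij|ji] := ltnP (nth 0%N s i) (nth 0%N s j).
  by rewrite rank_lt// mem_nth.
by apply/negbTE; rewrite -leqNgt rank_le.
Qed.

(** * Collections read off a word *)

(* [c] is the number of collections still to be completed, [M] the set of
   letters still missing from the current one, and [S] the set of letters it
   was started with; a collection completed by the letter [a] is followed by
   a collection of [next a S]. *)
Fixpoint collects (next : nat -> seq nat -> seq nat) (c : nat) (S M w : seq nat)
    : bool :=
  if c is c'.+1 then
    if w is a :: w' then
      if rem a M is [::] then collects next c' (next a S) (next a S) w'
      else collects next c S (rem a M) w'
    else false
  else true.

(* A letter outside [M] has already occurred in the current collection, so only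
   the rest of [s] is still to be found. *)
Lemma collects_all_words (L : seq nat) (c : nat) (M w s : seq nat) :
  uniq M -> collects (fun _ => id) c L M w ->
  uniq L -> size s = c -> all (mem L) s ->
  subseq (if head 0%N s \in M then s else behead s) w.
Proof.
elim: w c M s => [|a w IH] [|c] M [|x s]// Mu;
  rewrite ?if_same ?sub0seq//.
rewrite [head _ _]/= [behead _]/= [collects _ _ _ _ _]/=.
move=> + Lu [sc] /andP[xL sL].
have sM' := mem_rem_uniq a Mu.
have M'u := rem_uniq a Mu.
case E : (rem a M) => [|b M'] cw.
  have sw : subseq s w.
    have := IH _ _ _ Lu cw Lu sc sL.
    case: s sc sL => [|y s]//=; first by rewrite sub0seq.
    by move=> _ /andP[/= -> _].
  (* No letter other than [a] was missing, so a head in [M] equals [a]. *)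
  case: ifPn => xM; last by apply: (subseq_trans sw); exact: subseq_cons.
  have := sM' x; rewrite E !inE xM andbT => /esym/negbFE/eqP ->.
  by rewrite /= eqxx.
rewrite -E in cw M'u.
have xsL : all (mem L) (x :: s) by apply/andP.
have := IH c.+1 _ (x :: s) M'u cw Lu (congr1 succn sc) xsL.
rewrite [head _ _]/= [behead _]/= sM' inE; case: eqVneq => [->|xa] sw.
  have {}sw : subseq s w := sw.
  case: ifP => _; first by rewrite /= eqxx.
  by apply: (subseq_trans sw); exact: subseq_cons.
by apply: (subseq_trans sw); exact: subseq_cons.
Qed.

(* The adversary requires next the letter whose first further occurrence comes
   last, that is, the letter that completes the current collection. *)
Lemma collects_perms (c : nat) (S M w : seq nat) :
  uniq S -> size S = c -> uniq M -> M != [::] -> {subset M <= S} ->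
  (forall p, perm_eq p S -> head 0%N p \in M -> subseq p w) ->
  collects (@rem nat) c S M w.
Proof.
elim: w c S M => [|a w IH] [|c] S M//= Su Sc Mu M0 MS pw.
  case: M M0 Mu MS pw => // x M _ _ MS /(_ (x :: rem x S)).
  by rewrite perm_sym perm_to_rem ?MS ?mem_head// => /(_ isT isT).
have M'u := rem_uniq a Mu.
have M'E := mem_rem_uniq a Mu.
case E : (rem a M) => [|b M'].
  have aM : a \in M.
    case: M M0 E {pw M'u M'E Mu MS} => //= x M _; rewrite inE eq_sym.
    by case: eqVneq.
  have S'c : size (rem a S) = c by rewrite size_rem ?MS// Sc.
  have [c0|c0] := eqVneq c 0%N; first by rewrite c0; case: (w).
  apply: IH => //; try exact: rem_uniq.
    by rewrite -size_eq0 S'c.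
  (* Prefixing [a] gives a permutation of [S] whose first letter is matched by the letter just
     read. *)
  move=> p pS' _; have := pw (a :: p).
  rewrite /= eqxx; apply => //.
  by rewrite perm_sym (perm_trans (perm_to_rem (MS _ aM)))// perm_cons perm_sym.
rewrite -E; apply: IH => //; first by rewrite E.
  by move=> x; rewrite M'E => /andP[_ /MS].
(* The head of [p] differs from [a], so an embedding of [p] cannot use the letter just read. *)
move=> p pS; rewrite M'E inE => /andP[pa /(pw _ pS)].
case: p pS pa => [|x p]//=; first by rewrite sub0seq.
by move=> _ /negbTE ->.
Qed.

(** * Uniform words of fixed length *)

(** For [k > 0], the probability that a uniform word of length [n] over [[k]] satisfies [Q]; the
    recursion conditions on the first letter. *)
Fixpoint word_prob (R : realType) (k n : nat) (Q : pred (seq nat)) : R :=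
  if n is n'.+1 then
    k%:R^-1 * \sum_(a < k) word_prob R k n' (fun w => Q (a.+1 :: w))
  else (Q [::])%:R.

Lemma le_word_prob (R : realType) (k n : nat) (Q Q' : pred (seq nat)) :
  (forall w, all (fun x => (1 <= x <= k)%N) w -> Q w -> Q' w) ->
  word_prob R k n Q <= word_prob R k n Q'.
Proof.
elim: n Q Q' => [|n IH] Q Q' QQ' /=.
  by rewrite ler_nat; case: (Q [::]) (QQ' [::] isT) => // ->.
rewrite ler_wpM2l ?invr_ge0 ?ler0n// ler_sum// => a _.
by apply: IH => w wk; apply: QQ'; rewrite /= ltn_ord.
Qed.

Lemma word_prob_cst (R : realType) (k n : nat) (b : bool) :
  (0 < k)%N -> word_prob R k n (fun=> b) = b%:R.
Proof.
move=> k0; elim: n => [//|n IH] /=.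
rewrite (eq_bigr (fun=> b%:R)) ?IH// sumr_const card_ord -[b%:R *+ k]mulr_natl.
by rewrite mulKf// pnatr_eq0 -lt0n.
Qed.

Lemma sumr_letters_if (R : realType) (k : nat) (M : seq nat) (A B : R) :
  uniq M -> {subset M <= iota 1 k} ->
  \sum_(a < k) (if a.+1 \in M then A else B) =
  (size M)%:R * A + (k%:R - (size M)%:R) * B.
Proof.
move=> Mu Mk.
rewrite (eq_bigr (fun a : 'I_k => B + (a.+1 \in M)%:R * (A - B))); last first.
  by move=> a _; case: ifP => _; rewrite ?mulr1n ?mulr0n; ring.
rewrite big_split/= sumr_const card_ord -mulr_suml -natr_sum.
suff -> : (\sum_(a < k) (a.+1 \in M) = size M)%N by ring.
rewrite -(big_mkord xpredT (fun a => nat_of_bool (a.+1 \in M))).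
rewrite -(big_add1 _ _ 0 k.+1 xpredT (fun a => nat_of_bool (a \in M))).
rewrite (eq_bigr (fun a => if a \in M then 1%N else 0%N)); last first.
  by move=> a _; case: ifP.
rewrite -big_mkcond sum1_count /index_iota subSS subn0 -size_filter.
apply/perm_size/uniq_perm => //; first by rewrite filter_uniq ?iota_uniq.
move=> a; rewrite mem_filter; case: (boolP (a \in M)) => //= aM.
exact: Mk.
Qed.

(** * Moments of the collection times and Chebyshev's inequality *)

(* The expectation ([p = 1]) and a bound for the variance ([p = 2]) of the
   number of uniform letters among [k] needed to see [m] given ones: while [i]
   of them are missing, a letter is one of these with probability [i / k]. *)
Definition collection_sum (R : realType) (k p m : nat) : R :=
  \sum_(1 <= i < m.+1) (k%:R / i%:R) ^+ p.

(** The index [j] counts the collections still to be completed, the current one included, and [r j]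
    is the size of that one. *)
Definition collections_sum (R : realType) (k : nat) (r : nat -> nat)
    (p c : nat) : R :=
  \sum_(1 <= j < c.+1) collection_sum R k p (r j).

Lemma collection_sum0 (R : realType) (k p : nat) : collection_sum R k p 0 = 0.
Proof. by rewrite /collection_sum big_geq. Qed.

Lemma collection_sumS (R : realType) (k p m : nat) :
  collection_sum R k p m.+1 =
  collection_sum R k p m + (k%:R / m.+1%:R) ^+ p.
Proof. by rewrite /collection_sum big_nat_recr. Qed.

Lemma collection_sum_ge0 (R : realType) (k p m : nat) :
  0 <= collection_sum R k p m.
Proof. by apply: sumr_ge0 => i _; rewrite exprn_ge0// divr_ge0. Qed.

Lemma collections_sum0 (R : realType) (k : nat) (r : nat -> nat) (p : nat) :
  collections_sum R k r p 0 = 0.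
Proof. by rewrite /collections_sum big_geq. Qed.

Lemma collections_sumS (R : realType) (k : nat) (r : nat -> nat) (p c : nat) :
  collections_sum R k r p c.+1 =
  collection_sum R k p (r c.+1) + collections_sum R k r p c.
Proof. by rewrite /collections_sum big_nat_recr//= addrC. Qed.

Lemma collections_sum_ge0 (R : realType) (k : nat) (r : nat -> nat)
    (p c : nat) :
  0 <= collections_sum R k r p c.
Proof. by apply: sumr_ge0 => j _; exact: collection_sum_ge0. Qed.

(* [v + (mu + x) ^+ 2] bounds the second moment of [tau + x], where [tau] is the
   remaining time; conditioning on the next letter gives this inequality. *)
Lemma second_moment_step (R : realType) (k m : nat) (mu v x : R) :
  (0 < k)%N -> (0 < m)%N ->
  k%:R^-1 * (m%:R * (v + (mu + x + 1) ^+ 2) + (k%:R - m%:R) *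
    (v + (k%:R / m%:R) ^+ 2 + (mu + k%:R / m%:R + x + 1) ^+ 2)) <=
  v + (k%:R / m%:R) ^+ 2 + (mu + k%:R / m%:R + x) ^+ 2.
Proof.
move=> k0 m0.
(* The slack is exactly 1: it comes from bounding the variance [(k / m) ^+ 2 - k / m] of a geometric
   time by [(k / m) ^+ 2]. *)
rewrite -subr_ge0 [leRHS](_ : _ = 1) ?ler01//.
have k0' : k%:R != 0 :> R by rewrite pnatr_eq0 -lt0n.
have m0' : m%:R != 0 :> R by rewrite pnatr_eq0 -lt0n.
by field; rewrite k0' m0'.
Qed.

Definition letter_set (k m : nat) (S : seq nat) : Prop :=
  [/\ uniq S, {subset S <= iota 1 k} & size S = m].

Definition next_letter_set (k : nat) (next : nat -> seq nat -> seq nat)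
    (r : nat -> nat) : Prop :=
  forall c a S, letter_set k (r c.+2) S -> a \in S ->
    letter_set k (r c.+1) (next a S).

(** The sign of [e] selects the tail: completion within [n] letters if negative, failure if
    positive. The numerator is a nonnegative supermartingale which at the end of the run is at least
    [e ^+ 2] on the event. *)
Lemma collects_second_moment (R : realType) (k : nat)
    (next : nat -> seq nat -> seq nat) (r : nat -> nat) (e : R)
    (n c : nat) (S M : seq nat) :
  (0 < k)%N -> (forall j, (0 < r j.+1)%N) -> next_letter_set k next r ->
  e != 0 -> letter_set k (r c.+1) S -> uniq M -> {subset M <= S} ->
  (0 < size M)%N ->
  word_prob R k n (fun w => collects next c.+1 S M w == (e < 0)) <=
  (collection_sum R k 2 (size M) + collections_sum R k r 2 c +
   (collection_sum R k 1 (size M) + collections_sum R k r 1 c + e - n%:R) ^+ 2)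
  / e ^+ 2.
Proof.
move=> k0 r0 nextP e0; have ee : 0 < e ^+ 2 by rewrite exprn_even_gt0.
elim: n c S M => [|n IH] c S M Sr Mu MS M0.
  (* No letters are left and the task is unfinished: the event requires [e > 0], and adding a
     nonnegative mean to [e] only increases the square. *)
  rewrite [word_prob _ _ _ _]/= ler_pdivlMr// subr0.
  have v0 := addr_ge0 (collection_sum_ge0 R k 2 (size M))
    (collections_sum_ge0 R k r 2 c).
  have mu0 := addr_ge0 (collection_sum_ge0 R k 1 (size M))
    (collections_sum_ge0 R k r 1 c).
  case: (ltgtP e 0) e0 => // e0 _; last by rewrite eqxx mul1r; nra.
  by rewrite mul0r addr_ge0 ?sqr_ge0.
have [Su Sk Sc] := Sr.
set v := collections_sum R k r 2 c; set mu := collections_sum R k r 1 c.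
pose F m : R := (collection_sum R k 2 m + v +
  (collection_sum R k 1 m + mu + e - n%:R) ^+ 2) / e ^+ 2.
have letterF (a : 'I_k) :
    word_prob R k n
      (fun w => collects next c.+1 S M (a.+1 :: w) == (e < 0)) <=
    if a.+1 \in M then F (size M).-1 else F (size M).
  case: ifPn => aM; last first.
    rewrite [X in word_prob _ _ _ X](_ : _ =
        fun w => collects next c.+1 S M w == (e < 0)); first exact: IH.
    by apply/funext => w /=; rewrite rem_id//; case: (M) M0.
  have sM' : size (rem a.+1 M) = (size M).-1 by rewrite size_rem.
  case E : (rem a.+1 M) => [|b M'].
    rewrite -sM' E /F !collection_sum0 /v /mu.
    rewrite [X in word_prob _ _ _ X](_ : _ = fun w =>
      collects next c (next a.+1 S) (next a.+1 S) w == (e < 0)); last first.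
      by apply/funext => w /=; rewrite E.
    (* After the last collection the event is [e < 0], and then [(e - n) ^+ 2] is at least
       [e ^+ 2]. *)
    case: c Sr {Sc v mu F} => [|c] Sr.
      rewrite [X in word_prob _ _ _ X](_ : _ = fun=> true == (e < 0)).
        rewrite word_prob_cst// !collections_sum0 ler_pdivlMr//.
        have : 0 <= n%:R :> R by [].
        case: (ltgtP e 0) e0 => // e0 _ n0; first by rewrite eqxx mul1r; nra.
        by rewrite mul0r addr_ge0 ?sqr_ge0 ?addr0.
      by apply/funext => -[].
    rewrite !add0r !collections_sumS.
    have [Su' Sk' Sc'] := nextP _ _ _ Sr (MS _ aM).
    by rewrite -Sc'; apply: IH; rewrite ?Sc'//; exact: nextP (MS _ aM).
  rewrite [X in word_prob _ _ _ X](_ : _ =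
      fun w => collects next c.+1 S (rem a.+1 M) w == (e < 0)).
    rewrite -sM'; apply: IH => //; first exact: rem_uniq.
      by move=> x /mem_rem /MS.
    by rewrite E.
  by apply/funext => w /=; rewrite E.
rewrite [word_prob _ _ _ _]/=.
apply: (@le_trans _ _ (k%:R^-1 *
    \sum_(a < k) if a.+1 \in M then F (size M).-1 else F (size M))).
  by rewrite ler_wpM2l ?invr_ge0 ?ler0n// ler_sum// => a _; exact: letterF.
rewrite sumr_letters_if//; last by move=> x /MS /Sk.
case: (size M) M0 {letterF} => // m _.
rewrite /F ler_pdivlMr//= !collection_sumS.
(* The shift is [e - n.+1], which becomes [e - n] once the letter is read. *)
have := second_moment_step R k m.+1 (collection_sum R k 1 m + mu)
  (collection_sum R k 2 m + v) (e - n.+1%:R) k0 isT.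
rewrite -subr_ge0 => step; rewrite -subr_ge0; apply: (le_trans step).
rewrite -!natr1 !expr1 le_eqVlt; apply/orP; left; apply/eqP.
have k0' : k%:R != 0 :> R by rewrite pnatr_eq0 -lt0n.
have m0' : m%:R + 1 != 0 :> R by rewrite natr1 pnatr_eq0.
by field; rewrite k0' m0' e0.
Qed.

(** Taking for [e] the difference between [n] and the mean makes the initial square vanish, so only
    the variance bound remains. *)
Lemma collects_chebyshev (R : realType) (k : nat)
    (next : nat -> seq nat -> seq nat) (r : nat -> nat)
    (n c : nat) (S : seq nat) :
  (0 < k)%N -> (forall j, (0 < r j.+1)%N) -> next_letter_set k next r ->
  letter_set k (r c.+1) S -> n%:R != collections_sum R k r 1 c.+1 ->
  word_prob R k n (fun w => collects next c.+1 S S w ==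
    (n%:R < collections_sum R k r 1 c.+1)) <=
  collections_sum R k r 2 c.+1 / (n%:R - collections_sum R k r 1 c.+1) ^+ 2.
Proof.
move=> k0 r0 nextP Sr; rewrite -subr_eq0 -subr_lt0 => e0.
have [Su _ Sc] := Sr.
have := collects_second_moment R k next r _ n c S S k0 r0 nextP e0 Sr Su.
move=> /(_ (fun x => id)); rewrite Sc => /(_ (r0 c)) /le_trans; apply.
rewrite -!collections_sumS (_ : (_ + _ - _) ^+ 2 = 0) ?addr0//.
by rewrite addrCA subrr addr0 subrr expr0n.
Qed.

(** * Harmonic sums and the size of the moments *)

Definition harmonic_sum (R : realType) (n : nat) : R :=
  \sum_(1 <= i < n.+1) i%:R^-1.

Lemma harmonic_sumS (R : realType) (n : nat) :
  harmonic_sum R n.+1 = harmonic_sum R n + n.+1%:R^-1.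
Proof. by rewrite /harmonic_sum big_nat_recr. Qed.

Lemma collection_sum1E (R : realType) (k m : nat) :
  collection_sum R k 1 m = k%:R * harmonic_sum R m.
Proof. by rewrite /harmonic_sum mulr_sumr. Qed.

Lemma sum_harmonic_sum (R : realType) (n : nat) :
  \sum_(1 <= j < n.+1) harmonic_sum R j = n.+1%:R * harmonic_sum R n - n%:R.
Proof.
elim: n => [|n IH]; first by rewrite /harmonic_sum !big_geq// mulr0 subr0.
have n0 : n%:R + 1 != 0 :> R by rewrite natr1 pnatr_eq0.
by rewrite big_nat_recr//= IH harmonic_sumS -!natr1; field.
Qed.

Lemma harmonic_sum_ge0 (R : realType) (n : nat) : 0 <= harmonic_sum R n.
Proof. by apply: sumr_ge0 => i _; rewrite invr_ge0. Qed.

(** The induction carries the sharper factor [2 - 1 / m], because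
    [1 / (m + 1) ^+ 2 <= 1 / m - 1 / (m + 1)]. *)
Lemma collection_sum2_le (R : realType) (k m : nat) :
  collection_sum R k 2 m <= 2 * k%:R ^+ 2.
Proof.
have [->|] := posnP m; first by rewrite collection_sum0 mulr_ge0// exprn_ge0.
case: m => // m _.
apply: (@le_trans _ _ ((2 - m.+1%:R^-1) * k%:R ^+ 2)); last first.
  by rewrite ler_wpM2r ?exprn_ge0// gerBl invr_ge0.
elim: m => [|m IH].
  by rewrite collection_sumS collection_sum0 invr1; lra.
rewrite collection_sumS; apply: (le_trans (lerD IH (lexx _))).
rewrite expr_div_n [_ / _]mulrC -mulrDl ler_wpM2r ?exprn_ge0//.
rewrite -addrA lerD2l -!natr1.
have : 0 < m%:R + 1 :> R by rewrite natr1 ltr0n.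
move: (m%:R + 1) => x x0.
rewrite -subr_ge0 [leRHS](_ : _ = x^-1 * (x + 1)^-1 ^+ 2).
  by rewrite mulr_ge0 ?exprn_ge0 ?invr_ge0//; lra.
by field; lra.
Qed.

Lemma collections_sum2_le (R : realType) (k : nat) (r : nat -> nat) :
  collections_sum R k r 2 k <= 2 * k%:R ^+ 3.
Proof.
apply: (@le_trans _ _ (\sum_(1 <= j < k.+1) (2 * k%:R ^+ 2))).
  by apply: ler_sum => j _; exact: collection_sum2_le.
by rewrite sumr_const_nat subSS subn0 -mulr_natr; lra.
Qed.

Lemma collections_sum1_cst (R : realType) (k : nat) :
  collections_sum R k (fun=> k) 1 k = k%:R ^+ 2 * harmonic_sum R k.
Proof.
rewrite /collections_sum sumr_const_nat subSS subn0 collection_sum1E.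
by rewrite -mulr_natr; ring.
Qed.

(** The exact mean exceeds this bound by [k * harmonic_sum R k], which is dropped. *)
Lemma collections_sum1_id_ge (R : realType) (k : nat) :
  k%:R ^+ 2 * (harmonic_sum R k - 1) <= collections_sum R k id 1 k.
Proof.
rewrite /collections_sum (eq_bigr _ (fun j _ => collection_sum1E R k j)).
rewrite -mulr_sumr sum_harmonic_sum -natr1.
have := harmonic_sum_ge0 R k; have : 0 <= k%:R :> R by [].
by nra.
Qed.

(** * Euler's constant *)

Lemma ln_succ_le (R : realType) (n : nat) :
  (0 < n)%N -> ln n.+1%:R <= ln n%:R + n%:R^-1 :> R.
Proof.
move=> n0; have n0' : 0 < n%:R :> R by rewrite ltr0n.
rewrite (_ : n.+1%:R = n%:R * (1 + n%:R^-1)); last first.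
  by rewrite -natr1; field; lra.
have V0 : 0 < n%:R^-1 :> R by rewrite invr_gt0.
rewrite lnM ?posrE ?addr_gt0//.
by rewrite lerD2l le_ln1Dx// (lt_trans _ V0)// ltrN10.
Qed.

Lemma ln_succ_ge (R : realType) (n : nat) :
  (0 < n)%N -> ln n%:R + n.+1%:R^-1 <= ln n.+1%:R :> R.
Proof.
move=> n0; have n0' : 0 < n%:R :> R by rewrite ltr0n.
have V1 : n.+1%:R^-1 < 1 :> R by rewrite invf_lt1 ?ltr0n// ltr1n ltnS.
rewrite -lerBrDr.
rewrite [X in ln X](_ : n%:R = n.+1%:R * (1 - n.+1%:R^-1)); last first.
  by rewrite -natr1; field; lra.
rewrite lnM ?posrE ?ltr0n ?subr_gt0//.
by rewrite lerD2l le_ln1Dx// ltrN2.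
Qed.

(** The middle term is nonincreasing in [n], while the same term minus [1 / n] is nondecreasing; the
    limit lies between the two. *)
Lemma euler_gamma_bounds (R : realType) (n : nat) : (0 < n)%N ->
  euler_gamma R <= harmonic_sum R n - ln n%:R <= euler_gamma R + n%:R^-1.
Proof.
case: n => // n _.
pose u (i : nat) : R := harmonic_sum R i - ln i%:R.
have u_noninc : {homo [sequence u i.+1]_i : i j / (i <= j)%N >-> j <= i}.
  apply/nonincreasing_seqP => i; rewrite /u /= (harmonic_sumS R i.+1).
  have := ln_succ_ge R i.+1 isT.
  by move: (ln i.+2%:R) (ln i.+1%:R) (i.+2%:R^-1) => x y z; lra.
have v_nondec : {homo (fun i => u i.+1 - i.+1%:R^-1) :
    i j / (i <= j)%N >-> i <= j}.
  apply/nondecreasing_seqP => i; rewrite /u /= (harmonic_sumS R i.+1).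
  have := ln_succ_le R i.+1 isT.
  move: (ln i.+2%:R) (ln i.+1%:R) (i.+1%:R^-1) (i.+2%:R^-1) => x y z t.
  by lra.
have u_ge i j : (i <= j)%N -> u i.+1 - i.+1%:R^-1 <= u j.+1.
  move=> ij; apply: le_trans (v_nondec _ _ ij) _.
  by rewrite gerBl invr_ge0.
have cu : cvgn [sequence u i.+1]_i.
  apply: nonincreasing_is_cvgn => //.
  by exists (u 1%N - 1%:R^-1) => _ [i _ <-]; exact: u_ge.
have gE : euler_gamma R = limn [sequence u i.+1]_i.
  by apply: cvg_lim => //; rewrite -cvg_shiftS.
rewrite gE; apply/andP; split; first exact: nonincreasing_cvgn_ge.
rewrite -lerBlDr; apply: limr_ge => //.
by exists n => // i /= ni; exact: u_ge.
Qed.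

(** * From random letters to uniform words *)

(** Letters take countably many values, so the event splits into countably many pieces according to
    the last letter. *)
Lemma measurable_prefix (d : measure_display) (T : measurableType d)
    (R : realType) (P : probability T R) (X : nat -> {RV P >-> nat})
    (n : nat) (Q : seq nat -> Prop) :
  measurable [set t | Q (mkseq (X ^~ t) n)].
Proof.
elim: n Q => [|n IH] Q.
  have [q|q] := pselect (Q [::]).
    by rewrite (_ : mkset _ = setT)//; apply/seteqP; split.
  by rewrite (_ : mkset _ = set0)//; apply/seteqP; split.
rewrite (_ : mkset _ = \bigcup_a (X n @^-1` [set a] `&`
    [set t | Q (rcons (mkseq (X ^~ t) n) a)])).
  apply: bigcup_measurable => a _; apply: measurableI;
    last exact: (IH (fun v => Q (rcons v a))).
  exact: measurable_funPTI.
apply/seteqP; split => t /=; rewrite mkseqS.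
  by move=> Qt; exists (X n t).
by move=> [a _ [/= -> ?]].
Qed.

Lemma prob_prefix_eq (d : measure_display) (T : measurableType d)
    (R : realType) (P : probability T R) (k : nat) (X : nat -> {RV P >-> nat})
    (w : seq nat) :
  iid_uniform_letters k X -> all (fun x => (1 <= x <= k)%N) w ->
  P [set t | mkseq (X ^~ t) (size w) = w] = (k%:R^-1 ^+ size w)%:E.
Proof.
move=> [indX unifX] /allP wk.
have := indX [fset i in iota 0 (size w)]%fset
  (fun i => [set nth 0%N w i]) (fun _ _ => I).
rewrite (_ : \bigcap_(i in _) _ = [set t | mkseq (X ^~ t) (size w) = w]).
  move=> ->; rewrite (eq_big_seq (fun=> (k%:R^-1)%:E)); last first.
    move=> i; rewrite !inE mem_iota add0n => /andP[_ iw].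
    by rewrite unifX// wk// mem_nth.
  rewrite prodEFin big_const_seq count_predT card_fseq undup_id ?iota_uniq//.
  by rewrite size_iota -Monoid.iteropE.
apply/seteqP; split => t /=.
  move=> Xw; apply: (@eq_from_nth _ 0%N); rewrite size_mkseq// => i iw.
  by rewrite nth_mkseq// Xw//= !inE mem_iota.
move=> Xw i /=; rewrite !inE mem_iota add0n => /andP[_ iw].
by rewrite -[in RHS]Xw nth_mkseq.
Qed.

Lemma prob_letter_out (d : measure_display) (T : measurableType d)
    (R : realType) (P : probability T R) (k : nat) (X : {RV P >-> nat}) :
  (0 < k)%N -> uniform_letter k X ->
  P [set t | ~~ (1 <= X t <= k)%N] = 0%E.
Proof.
move=> k0 unifX.
have mX (A : set nat) : measurable (X @^-1` A) by exact: measurable_funPTI.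
rewrite (_ : mkset _ = ~` \big[setU/set0]_(a < k) (X @^-1` [set a.+1])).
  rewrite probability_setC; last by apply: bigsetU_measurable.
  rewrite (measure_bigsetU _ (F := fun a => X @^-1` [set a.+1]))//.
    rewrite (eq_bigr (fun=> (k%:R^-1)%:E)); last first.
      by move=> a _; apply: unifX; exact: ltn_ord.
    rewrite sumEFin sumr_const card_ord -[k%:R^-1 *+ k]mulr_natl divff ?subee//.
    by rewrite pnatr_eq0 -lt0n.
  by apply/trivIsetP => i j _ _ ij; apply/seteqP; split => // t /= [-> []]/eqP;
    rewrite (negbTE ij).
rewrite -(bigcup_mkord k (fun a => X @^-1` [set a.+1])).
apply/seteqP; split => t /=.
  by move=> /negP Xk [a /= ak Xa]; apply: Xk; rewrite Xa.
move=> Xk; apply/negP => /andP[X0 Xle]; apply: Xk.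
by exists (X t).-1 => /=; lia.
Qed.

(** Induction on [n] for all [w]: the next letter is either one of [1, ..., k], treated by the union
    bound, or outside this range, a null event. *)
Lemma prob_prefix_cat_le (d : measure_display) (T : measurableType d)
    (R : realType) (P : probability T R) (k : nat) (X : nat -> {RV P >-> nat})
    (n : nat) (w : seq nat) (Q : pred (seq nat)) :
  (0 < k)%N -> iid_uniform_letters k X ->
  all (fun x => (1 <= x <= k)%N) w ->
  (P [set t | mkseq (X ^~ t) (size w) = w /\
              Q (mkseq (X ^~ t) (size w + n))] <=
   (k%:R^-1 ^+ size w * word_prob R k n (fun v => Q (w ++ v)))%:E)%E.
Proof.
move=> k0 iidX; elim: n w => [|n IH] w wk.
  rewrite addn0 /= cats0.
  case: (boolP (Q w)) => Qw.
    rewrite mulr1 -(prob_prefix_eq _ _ _ _ _ X)//.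
    rewrite le_eqVlt; apply/orP; left; apply/eqP; congr (P _).
    by apply/seteqP; split => t /=; [case|move=> ->].
  rewrite mulr0 (_ : mkset _ = set0) ?measure0//.
  by apply/seteqP; split => // t /= [->]; rewrite (negbTE Qw).
pose A a := [set t | mkseq (X ^~ t) (size (rcons w a)) = rcons w a /\
  Q (mkseq (X ^~ t) (size (rcons w a) + n))].
have mA a : measurable (A a).
  apply: (measurableI
    [set t | mkseq (X ^~ t) (size (rcons w a)) = rcons w a]
    [set t | Q (mkseq (X ^~ t) (size (rcons w a) + n))]).
    exact: (measurable_prefix _ _ _ _ _ _ (eq^~ _)).
  exact: (measurable_prefix _ _ _ _ _ _ Q).
pose N := [set t | ~~ (1 <= X (size w) t <= k)%N].
have mN : measurable N.
  rewrite (_ : N = X (size w) @^-1` [set x | ~~ (1 <= x <= k)%N])//.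
  exact: measurable_funPTI.
have mB : measurable [set t | mkseq (X ^~ t) (size w) = w /\
    Q (mkseq (X ^~ t) (size w + n.+1))].
  apply: (measurableI [set t | mkseq (X ^~ t) (size w) = w]
    [set t | Q (mkseq (X ^~ t) (size w + n.+1))]).
    exact: (measurable_prefix _ _ _ _ _ _ (eq^~ _)).
  exact: (measurable_prefix _ _ _ _ _ _ Q).
have mAk : measurable (\big[setU/set0]_(a < k) A a.+1).
  exact: bigsetU_measurable.
apply: (@le_trans _ _ (P (\big[setU/set0]_(a < k) A a.+1 `|` N))).
  apply: le_measure; [exact/mem_set|exact/mem_set/measurableU|].
  move=> t /= [Xw Qt].
  have [/andP[X0 Xk]|Xk] := boolP (1 <= X (size w) t <= k)%N; last by right.
  left; rewrite -(bigcup_mkord k (fun a => A a.+1)).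
  exists (X (size w) t).-1; first by rewrite /=; lia.
  by rewrite prednK// /A /= size_rcons mkseqS Xw addSnnS.
apply: (le_trans (measureU2 P mAk mN)).
rewrite [X in (_ + X)%E](prob_letter_out _ _ _ _ k) ?adde0//;
  last exact: iidX.2.
apply: (le_trans (Boole_inequality P (A := fun a => A a.+1) _)) => //.
rewrite /= mulr_sumr mulr_sumr -sumEFin; apply: lee_sum => a _.
apply: le_trans (IH _ _) _; first by rewrite all_rcons wk ltn_ord.
rewrite lee_fin size_rcons exprSr -mulrA le_eqVlt; apply/orP; left; apply/eqP.
by congr (_ * (_ * word_prob _ _ _ _));
  apply/funext => v; rewrite cat_rcons.
Qed.

Lemma prob_prefix_le (d : measure_display) (T : measurableType d)
    (R : realType) (P : probability T R) (k : nat) (X : nat -> {RV P >-> nat})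
    (n : nat) (Q : pred (seq nat)) :
  (0 < k)%N -> iid_uniform_letters k X ->
  (P [set t | Q (mkseq (X ^~ t) n)] <= (word_prob R k n Q)%:E)%E.
Proof.
move=> k0 iidX; have := prob_prefix_cat_le d T R P k X n [::] Q k0 iidX isT.
rewrite /= expr0 mul1r add0n; apply: le_trans.
rewrite le_eqVlt; apply/orP; left; apply/eqP; congr (P _).
by apply/seteqP; split => t /=; [|case].
Qed.

(** * The waiting time in terms of prefixes *)

Lemma superpattern_time_ge (R : realType) (k : nat) (w : nat -> nat) (x : R) :
  (x%:E <= superpattern_time R k w)%E <->
  forall n : nat, superpattern k (mkseq w n) -> x <= n%:R.
Proof.
split=> [xX n sn|nx].
  by rewrite -lee_fin (le_trans xX)//; apply: ereal_inf_lbound; exists n.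
by apply: le_ereal_inf_tmp => _ [n sn <-]; rewrite lee_fin nx.
Qed.

(** The infimum of integer times is attained: if no time up to [x] works, all working times are at
    least [(Num.trunc x).+1], which exceeds [x]. *)
Lemma superpattern_time_le (R : realType) (k : nat) (w : nat -> nat) (x : R) :
  (superpattern_time R k w <= x%:E)%E <->
  exists2 n : nat, n%:R <= x & superpattern k (mkseq w n).
Proof.
split=> [Xx|[n nx sn]]; last first.
  by apply: ge_ereal_inf; exists n%:R%:E; [exists n|rewrite lee_fin].
have x0 : 0 <= x.
  rewrite -lee_fin; apply: le_trans Xx.
  by apply/superpattern_time_ge => n _; exact: ler0n.
apply: contrapT => nx.
suff : ((Num.trunc x).+1%:R%:E <= superpattern_time R k w)%E.
  by move=> /le_trans /(_ Xx); rewrite lee_fin leNgt truncnS_gt.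
apply/superpattern_time_ge => n sn.
rewrite ler_nat ltnNge; apply/negP => nt; apply: nx; exists n => //.
have /andP[+ _] := truncn_itv x0.
by apply: le_trans; rewrite ler_nat.
Qed.

(** * Tail bounds for a fixed alphabet *)

Lemma prob_not_superpattern_le (d : measure_display) (T : measurableType d)
    (R : realType) (P : probability T R) (k : nat) (X : nat -> {RV P >-> nat})
    (n : nat) :
  (0 < k)%N -> iid_uniform_letters k X ->
  k%:R ^+ 2 * harmonic_sum R k < n%:R ->
  (P [set t | ~ superpattern k (mkseq (X ^~ t) n)] <=
   (2 * k%:R ^+ 3 / (n%:R - k%:R ^+ 2 * harmonic_sum R k) ^+ 2)%:E)%E.
Proof.
move=> k0 iidX nk.
rewrite (_ : mkset _ =
    [set t | ~~ `[< superpattern k (mkseq (X ^~ t) n) >]]); last first.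
  by apply/seteqP; split => t /= => /asboolPn.
apply: (le_trans (prob_prefix_le _ _ _ _ k X n
  (fun w => ~~ `[< superpattern k w >]) k0 iidX)).
rewrite lee_fin -collections_sum1_cst.
apply: (@le_trans _ _ (word_prob R k n (fun w =>
  collects (fun=> id) k (iota 1 k) (iota 1 k) w ==
  (n%:R < collections_sum R k (fun=> k) 1 k)))).
  apply: le_word_prob => w wk.
  (* As [n] lies above the mean, the event is that the collections are not completed. *)
  rewrite collections_sum1_cst ltNge (ltW nk) eqbF_neg.
  apply: contra => cw; apply/asboolP/superpattern_all_words => u uk /allP ua.
  have uL : all (mem (iota 1 k)) u.
    by apply/allP => x /ua; rewrite /= mem_iota; lia.
  (* At the start every letter is missing, so the whole of [u] is found and not only its tail. *)
  have := collects_all_words _ _ _ _ _ (iota_uniq _ _) cw (iota_uniq _ _) uk uL.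
  case: u uk ua uL => [|x u]//=; first by move=> e; move: k0; rewrite -e.
  by move=> _ _ /andP[/= -> _].
apply: (@le_trans _ _ (collections_sum R k (fun=> k) 2 k /
    (n%:R - collections_sum R k (fun=> k) 1 k) ^+ 2)); last first.
  by rewrite ler_wpM2r ?invr_ge0 ?sqr_ge0//; exact: collections_sum2_le.
have := collects_chebyshev R k (fun=> id) (fun=> k) n k.-1 (iota 1 k).
rewrite prednK//; apply=> //.
- by split; rewrite ?iota_uniq ?size_iota.
- by rewrite collections_sum1_cst gt_eqF.
Qed.

Lemma prob_superpattern_le (d : measure_display) (T : measurableType d)
    (R : realType) (P : probability T R) (k : nat) (X : nat -> {RV P >-> nat})
    (n : nat) :
  (0 < k)%N -> iid_uniform_letters k X ->
  n%:R < k%:R ^+ 2 * (harmonic_sum R k - 1) ->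
  (P [set t | superpattern k (mkseq (X ^~ t) n)] <=
   (2 * k%:R ^+ 3 / (k%:R ^+ 2 * (harmonic_sum R k - 1) - n%:R) ^+ 2)%:E)%E.
Proof.
move=> k0 iidX nk.
have nT : n%:R < collections_sum R k id 1 k.
  exact: lt_le_trans (collections_sum1_id_ge R k).
rewrite (_ : mkset _ =
    [set t | `[< superpattern k (mkseq (X ^~ t) n) >]]); last first.
  by apply/seteqP; split => t /= => /asboolP.
apply: (le_trans (prob_prefix_le _ _ _ _ k X n
  (fun w => `[< superpattern k w >]) k0 iidX)).
rewrite lee_fin.
apply: (@le_trans _ _ (word_prob R k n (fun w =>
  collects (@rem nat) k (iota 1 k) (iota 1 k) w ==
  (n%:R < collections_sum R k id 1 k)))).
  apply: le_word_prob => w wk /asboolP sw; rewrite nT eqb_id.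
  apply: collects_perms => //; rewrite ?iota_uniq ?size_iota//.
    by rewrite -size_eq0 size_iota -lt0n.
  by move=> p pk _; exact: superpattern_perm sw pk.
apply: (@le_trans _ _ (collections_sum R k id 2 k /
    (n%:R - collections_sum R k id 1 k) ^+ 2)).
  have := collects_chebyshev R k (@rem nat) id n k.-1 (iota 1 k).
  rewrite prednK//; apply=> //.
  - move=> c a S [Su Sk Sc] aS; split; first exact: rem_uniq.
      by move=> x /mem_rem /Sk.
    by rewrite size_rem// Sc.
  - by split; rewrite ?iota_uniq ?size_iota.
  - by rewrite lt_eqF.
(* Replacing the mean by its lower bound shrinks the deviation, hence enlarges the quotient. *)
have Tk := collections_sum1_id_ge R k.
apply: ler_pM; rewrite ?invr_ge0 ?sqr_ge0 ?collections_sum_ge0//.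
  exact: collections_sum2_le.
rewrite lef_pV2 ?posrE.
- by nra.
- by rewrite exprn_even_gt0//= subr_eq0 lt_eqF.
by rewrite exprn_gt0// subr_gt0.
Qed.

(** * The two-sided estimate *)

(** Reduces the event to countable unions of prefix events, which gives measurability and separates
    the two tails. *)
Lemma superpattern_time_itvE (R : realType) (T : Type) (k : nat)
    (X : nat -> T -> nat) (l u : R) :
  [set t | (l%:E <= superpattern_time R k (X ^~ t) <= u%:E)%E] =
  ~` ((\bigcup_(n in [set n : nat | n%:R < l])
         [set t | superpattern k (mkseq (X ^~ t) n)]) `|`
      ~` \bigcup_(n in [set n : nat | n%:R <= u])
         [set t | superpattern k (mkseq (X ^~ t) n)]).
Proof.
apply/seteqP; split => t /=.
  move=> /andP[/superpattern_time_ge lX /superpattern_time_le [m mu sm]].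
  move=> [[n /= + /lX]|]; first by rewrite ltNge => /negP.
  by apply; exists m.
move=> /not_orP[ne /contrapT [m mu sm]]; apply/andP; split; last first.
  by apply/superpattern_time_le; exists m.
apply/superpattern_time_ge => n sn; rewrite leNgt; apply/negP => nl.
by apply: ne; exists n.
Qed.

Lemma measurable_superpattern_by (d : measure_display) (T : measurableType d)
    (R : realType) (P : probability T R) (X : nat -> {RV P >-> nat})
    (k : nat) (D : set nat) :
  measurable (\bigcup_(n in D) [set t | superpattern k (mkseq (X ^~ t) n)]).
Proof.
apply: bigcup_measurable => n _.
exact: (measurable_prefix _ _ _ _ _ _ (superpattern k)).
Qed.

Lemma measurable_superpattern_time (d : measure_display) (T : measurableType d)
    (R : realType) (P : probability T R) (X : nat -> {RV P >-> nat})
    (k : nat) (l u : R) :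
  measurable [set t | (l%:E <= superpattern_time R k (X ^~ t) <= u%:E)%E].
Proof.
rewrite superpattern_time_itvE; apply/measurableC/measurableU.
  exact: measurable_superpattern_by.
by apply/measurableC; exact: measurable_superpattern_by.
Qed.

(** The constant 10 is 2 from the lower tail plus 8 from the upper one, where only half of the
    margin [omega * s] is kept. *)
Lemma prob_superpattern_time (d : measure_display) (T : measurableType d)
    (R : realType) (P : probability T R) (k : nat) (X : nat -> {RV P >-> nat})
    (omega : R)
    (lower : R := k%:R ^+ 2 * ln k%:R - (1 - euler_gamma R) * k%:R ^+ 2
       - omega * (k%:R `^ (3 / 2)))
    (upper : R := k%:R ^+ 2 * ln k%:R + euler_gamma R * k%:R ^+ 2
       + omega * (k%:R `^ (3 / 2))) :
  (0 < k)%N -> iid_uniform_letters k X -> 4 <= omega ->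
  ((1 - 10 / omega ^+ 2)%:E <=
   P [set t | (lower%:E <= superpattern_time R k (X ^~ t) <= upper%:E)%E])%E.
Proof.
move=> k0 iidX omega4.
set s := k%:R `^ (3 / 2) in lower upper *.
have k1 : 1 <= k%:R :> R by rewrite ler1n.
have s2 : s ^+ 2 = k%:R ^+ 3.
  rewrite /s -powR_mulrn ?powR_ge0// -powRrM -powR_mulrn ?ler0n//.
  by congr powR; lra.
have ks : k%:R <= s.
  by rewrite -[leLHS]powRr1 ?ler0n//; apply: ler_powR => //; lra.
have /andP[gamma_le gamma_ge] := euler_gamma_bounds R k k0.
have mean_lower : lower + omega * s <= k%:R ^+ 2 * (harmonic_sum R k - 1).
  have := ler_wpM2l (sqr_ge0 k%:R) gamma_le; rewrite /lower.
  by move: (ln k%:R) gamma_ge => l _; lra.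
have mean_upper : k%:R ^+ 2 * harmonic_sum R k <= upper - omega * s + k%:R.
  have kE : k%:R ^+ 2 * k%:R^-1 = k%:R :> R by rewrite expr2 mulfK//; lra.
  have := ler_wpM2l (sqr_ge0 k%:R) gamma_ge; rewrite [leRHS]mulrDr kE /upper.
  by move: (ln k%:R) gamma_le gamma_ge kE => l _ _ _; lra.
move: gamma_le gamma_ge => _ _.
have os0 : 0 < omega * s by rewrite mulr_gt0//; lra.
have deviation (c x : R) : 0 < c -> omega * s <= c * x ->
    2 * k%:R ^+ 3 / x ^+ 2 <= 2 * c ^+ 2 / omega ^+ 2.
  move=> c0 sx; have x0 : 0 < x by rewrite -(pmulr_rgt0 x c0) (lt_le_trans os0).
  rewrite ler_pdivrMr ?exprn_gt0// mulrAC ler_pdivlMr; last first.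
    by rewrite exprn_gt0//; lra.
  have : (omega * s) ^+ 2 <= (c * x) ^+ 2.
    by rewrite lerXn2r// nnegrE ltW// mulr_gt0.
  by rewrite !exprMn s2; lra.
rewrite superpattern_time_itvE.
set early := \bigcup_(n in _) _; set late := (X in _ `|` X).
have m_early : measurable early.
  exact: (measurable_superpattern_by _ _ _ P X k).
have m_late : measurable late.
  by apply/measurableC; exact: (measurable_superpattern_by _ _ _ P X k).
have P_late : (P late <= (8 / omega ^+ 2)%:E)%E.
  have upper0 : 0 <= upper.
    have := harmonic_sum_ge0 R k; nra.
  have /andP[tr1 tr2] := truncn_itv upper0.
  rewrite -natr1 in tr2.
  (* Truncation costs at most 1 and the bound on Euler's constant costs [k]; since [k + 1 <= 2 * s]
     and [4 <= omega], half of [omega * s] survives. *)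
  have dev : omega * s <=
      2 * ((Num.trunc upper)%:R - k%:R ^+ 2 * harmonic_sum R k) by nra.
  apply: (@le_trans _ _
    (P [set t | ~ superpattern k (mkseq (X ^~ t) (Num.trunc upper))])).
    apply: le_measure; first exact/mem_set.
      apply/mem_set.
      exact: (measurable_prefix _ _ _ _ _ _ (fun w => ~ superpattern k w)).
    by move=> t /= nt sn; apply: nt; exists (Num.trunc upper).
  apply: (le_trans (prob_not_superpattern_le _ _ _ _ k X _ k0 iidX _)).
    by nra.
  by rewrite lee_fin; apply: le_trans (deviation 2 _ _ dev) _ => //; lra.
have P_early : (P early <= (2 / omega ^+ 2)%:E)%E.
  have [lower0|lower0] := ltP lower 0.
    rewrite (_ : early = set0) ?measure0 ?lee_fin ?divr_ge0 ?sqr_ge0//.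
    apply/seteqP; split => // t [n /= nl _].
    by have : 0 <= n%:R :> R by []; lra.
  have /andP[tr1 tr2] := truncn_itv lower0.
  have dev : omega * s <=
      1 * (k%:R ^+ 2 * (harmonic_sum R k - 1) - (Num.trunc lower)%:R) by lra.
  apply: (@le_trans _ _
    (P [set t | superpattern k (mkseq (X ^~ t) (Num.trunc lower))])).
    apply: le_measure; first exact/mem_set.
      apply/mem_set; exact: (measurable_prefix _ _ _ _ _ _ (superpattern k)).
    (* Superpatterns persist in longer words, so the whole union lies in the event at the last
       integer time not above [lower]. *)
    move=> t [n /= nl]; apply: superpattern_subseq; apply: mkseq_subseq.
    by rewrite -ltnS -(ltr_nat R) (lt_trans nl).
  apply: (le_trans (prob_superpattern_le _ _ _ _ k X _ k0 iidX _)).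
    by nra.
  by rewrite lee_fin; apply: le_trans (deviation 1 _ _ dev) _ => //; lra.
rewrite probability_setC; last exact: measurableU.
rewrite EFinB; apply: leeB => //.
apply: (le_trans (measureU2 P m_early m_late)).
apply: (le_trans (leeD P_early P_late)).
by rewrite -EFinD lee_fin -mulrDl; lra.
Qed.

(** * Passage to the limit *)

Theorem theorem5 (R : realType)
    (d : nat -> measure_display) (T : forall k : nat, measurableType (d k))
    (P : forall k : nat, probability (T k) R)
    (letter : forall k : nat, nat -> {RV (P k) >-> nat})
    (iid_letter : forall k : nat, (1 <= k)%N ->
       iid_uniform_letters k (letter k))
    (omega : nat -> R) (omega_pinfty : omega k @[k --> \oo] --> +oo) :
  let X (k : nat) (t : T k) : \bar R :=
    superpattern_time R k (fun n => letter k n t) in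
  let lower (k : nat) : R :=
    k%:R ^+ 2 * ln k%:R - (1 - euler_gamma R) * k%:R ^+ 2
      - omega k * (k%:R `^ (3 / 2)) in
  let upper (k : nat) : R :=
    k%:R ^+ 2 * ln k%:R + euler_gamma R * k%:R ^+ 2
      + omega k * (k%:R `^ (3 / 2)) in
  P k [set t : T k | ((lower k)%:E <= X k t <= (upper k)%:E)%E]
    @[k --> \oo] --> (1%R)%:E.
Proof.
move=> X lower upper.
apply: (squeeze_cvge (f := fun k => (1 - 10 / omega k ^+ 2)%:E)
  (h := cst 1%:E)); last exact: cvg_cst.
  near=> k; have k0 : (0 < k)%N by near: k; exact: nbhs_infty_gt.
  rewrite probability_le1 ?andbT;
    last exact: measurable_superpattern_time.
  apply: prob_superpattern_time => //; first exact: iid_letter.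
  by near: k; move/cvgryPge: omega_pinfty; apply.
apply: cvg_EFin; first exact: nearW.
rewrite -[X in _ --> X]subr0 -[X in _ - X](mulr0 10).
apply: cvgB; first exact: cvg_cst.
apply: cvgMr.
apply/cvgrPdist_le => e e0; near=> k.
(* Together with the next bound this yields [e^-1 <= omega k ^+ 2]. *)
have w1 : 1 <= omega k by near: k; move/cvgryPge: omega_pinfty; apply.
have we : e^-1 <= omega k by near: k; move/cvgryPge: omega_pinfty; apply.
rewrite sub0r normrN ger0_norm ?invr_ge0 ?sqr_ge0//.
rewrite -[leRHS]invrK lef_pV2 ?posrE ?invr_gt0 ?exprn_gt0//; last by lra.
by nra.
Unshelve. all: by end_near. Qed.
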